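(* Let $\mathcal X$ be a finite alphabet and let $(\mathcal F_n)_{n\ge1}$, $\mathcal F_n\subseteq\mathcal P(\mathcal X^n)$, be a sequence of sets of probability distributions satisfying: (1) each $\mathcal F_n$ is convex and closed; (2) $\mathcal F_1$ contains a distribution with full support on $\mathcal X$; (3) if $q\in\mathcal F_{n+1}$ then its marginal on the first $n$ symbols lies in $\mathcal F_n$; (4) if $q\in\mathcal F_n$ and $q'\in\mathcal F_m$ then $q\otimes q'\in\mathcal F_{n+m}$; (5) each $\mathcal F_n$ is invariant under permutations of the $n$ coordinates; (6) for every $p\in\mathcal P(\mathcal X)$ with $p\notin\mathcal F_1$, $D^\infty(p\|\mathcal F):=\lim_{n\to\infty}\frac1n\inf_{q\in\mathcal F_n}D(p^{\otimes n}\|q)>0$. Then for all $p\in\mathcal P(\mathcal X)$ and all $\varepsilon\in(0,1)$, \[ \lim_{n\to\infty}\frac1n D_H^\varepsilon(\mathcal F_n\,\|\,p^{\otimes n}) = D(\mathcal F\|p):=\min_{q\in\mathcal F_1}D(q\|p), \] and in particular $\mathrm{Sanov}(p\|\mathcal F)=D(\mathcal F\|p)$.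
   Context: $\mathcal P(\mathcal Y)$ is the set of probability distributions on a finite set $\mathcal Y$; $D(q\|p)=\sum_x q(x)\log(q(x)/p(x))$ is the Kullback–Leibler divergence ($+\infty$ if $q\not\ll p$). For distributions $q,r$ on $\mathcal X^n$, $D_H^\varepsilon(q\|r)=-\log\min\{\sum_{x^n}a(x^n)r(x^n): a:\mathcal X^n\to[0,1],\ \sum_{x^n}(1-a(x^n))q(x^n)\le\varepsilon\}$, and $D_H^\varepsilon(\mathcal F_n\|r)=\inf_{q\in\mathcal F_n}D_H^\varepsilon(q\|r)$. $\mathrm{Sanov}(p\|\mathcal F)=\lim_{\varepsilon\to0^+}\liminf_{n\to\infty}\frac1nD_H^\varepsilon(\mathcal F_n\|p^{\otimes n})$. *)

(* Defs.v *)
From mathcomp Require Import all_boot all_order all_algebra all_fingroup.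
From mathcomp Require Import all_classical all_reals all_analysis.
Import Order.TTheory GRing.Theory Num.Theory.
Import numFieldNormedType.Exports.

Set Implicit Arguments.
Unset Strict Implicit.
Unset Printing Implicit Defensive.

Local Open Scope classical_set_scope.
Local Open Scope ring_scope.

Section Defs.
Variable R : realType.

Definition is_dist (T : finType) (q : T -> R) : Prop :=
  (forall x, 0 <= q x) /\ \sum_(x : T) q x = 1.

Definition iid (X : finType) (p : X -> R) (n : nat) : n.-tuple X -> R :=
  fun x => \prod_(i < n) p (tnth x i).
Arguments iid [X] p n.

Definition KL (T : finType) (q p : T -> R) : \bar R :=
  if [exists x, (q x != 0) && (p x == 0)] then +oo%E
  else (\sum_(x : T) (if q x == 0 then 0 else q x * ln (q x / p x)))%:E.

Definition beta_test (T : finType) (eps : R) (q r : T -> R) : R :=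
  inf [set s | exists a : T -> R,
         (forall x, 0 <= a x <= 1) /\
         \sum_(x : T) (1 - a x) * q x <= eps /\
         s = \sum_(x : T) a x * r x].

Definition DH (T : finType) (eps : R) (q r : T -> R) : \bar R :=
  let b := beta_test eps q r in
  if b == 0 then +oo%E else (- ln b)%:E.

Definition DH_set (T : finType) (eps : R) (F : set (T -> R)) (r : T -> R)
  : \bar R := ereal_inf [set DH eps q r | q in F].

Definition marg (X : finType) (n : nat) (q : n.+1.-tuple X -> R)
  : n.-tuple X -> R :=
  fun x => \sum_(y : X) q [tuple of rcons x y].

Definition tensor (X : finType) (n m : nat)
  (q : n.-tuple X -> R) (q' : m.-tuple X -> R) : (n + m).-tuple X -> R :=
  fun x => q [tuple tnth x (lshift m i) | i < n] *
           q' [tuple tnth x (rshift n j) | j < m].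

Definition permd (X : finType) (n : nat) (s : {perm 'I_n}) (q : n.-tuple X -> R)
  : n.-tuple X -> R :=
  fun x => q [tuple tnth x (s i) | i < n].

Definition Dinf (X : finType) (F : forall n : nat, set (n.-tuple X -> R))
  (p : X -> R) : \bar R :=
  limn (fun n : nat => ((n.+1)%:R^-1)%:E *
          ereal_inf [set KL (iid p n.+1) q | q in F n.+1])%E.

Definition DFp (X : finType) (F : forall n : nat, set (n.-tuple X -> R))
  (p : X -> R) : \bar R :=
  ereal_inf [set KL q (iid p 1) | q in F 1%N].

End Defs.
Arguments iid {R} [X] p n.

(* Main.v *)
Require Import Defs.
From mathcomp Require Import all_boot all_order all_algebra all_fingroup.
From mathcomp Require Import all_classical all_reals all_analysis.
From mathcomp Require Import ring lra.
Import Order.TTheory GRing.Theory Num.Theory.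
Import numFieldNormedType.Exports.
Local Open Scope classical_set_scope.
Local Open Scope ring_scope.

(** Upper bound: for [q] in [F_1] the powers of [q] lie in [F_n], and the strong
    converse of Stein's lemma, with a Chernoff bound, applies to them.

    Lower bound: fix [L < D(F||p)] and cover the simplex by finitely many open
    sets of types of two kinds. Around [s] in [F_1] there is a half-space of
    types, cut out by a log-likelihood ratio, of [p^n]-probability at most
    [exp (- n L)]. Around [t] outside [F_1] there is an open set of types whose
    probability under every [q] in [F_n] tends to 0: otherwise, averaging the
    marginals of [q] on [m = n / k] coordinates over all choices of these
    coordinates, i.e. sampling [m] letters without replacement, gives an element
    of [F_m] that dominates [exp (- m c / 2) t^m] up to a constant, and this
    contradicts [D^oo(t||F) > 0]. The test that accepts the types of the first
    kind is then good for all [q] in [F_n] simultaneously. *)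

Set Implicit Arguments.
Unset Strict Implicit.

(** * Sums over tuples and product distributions *)

Section TupleSums.
Variables (R : realType) (X : finType).
Implicit Types (n m : nat).

Lemma sum_tuple_prod n (phi : X -> R) :
  \sum_(x : n.-tuple X) \prod_(i < n) phi (tnth x i) = (\sum_a phi a) ^+ n.
Proof.
have <- : \prod_(i < n) \sum_a phi a = (\sum_a phi a) ^+ n.
  by rewrite prodr_const card_ord.
rewrite bigA_distr_bigA /=.
rewrite (reindex (fun f : {ffun 'I_n -> X} => [tuple f i | i < n])) /=; last first.
  exists (fun x : n.-tuple X => [ffun i => tnth x i]) => [f _|x _].
    by apply/ffunP => i; rewrite ffunE tnth_mktuple.
  by apply: eq_from_tnth => i; rewrite tnth_mktuple ffunE.
by apply: eq_bigr => f _; apply: eq_bigr => i _; rewrite tnth_mktuple.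
Qed.

Lemma is_dist_iid n (p : X -> R) : is_dist p -> is_dist (iid p n).
Proof.
move=> [p0 p1]; split=> [x|]; first exact: prodr_ge0.
by rewrite /iid sum_tuple_prod p1 expr1n.
Qed.

(** The predicate lives on sequences, so that it makes sense for tuples of both lengths without
    casts. *)
Lemma sum_tuple_rcons n (f : n.+1.-tuple X -> R) (P : pred (seq X)) :
  \sum_(x : n.+1.-tuple X | P (tval x)) f x =
  \sum_(x : n.-tuple X) \sum_(y | P (rcons (tval x) y)) f [tuple of rcons x y].
Proof.
pose h (z : n.-tuple X * X) := [tuple of rcons z.1 z.2].
rewrite pair_big_dep /= (reindex h) //=.
exists (fun x : n.+1.-tuple X =>
  ([tuple tnth x (widen_ord (leqnSn n) i) | i < n], tnth x ord_max)).
- move=> [x y] _ /=; congr (_, _); last first.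
    by rewrite (tnth_nth y) /= nth_rcons size_tuple ltnn eqxx.
  apply: eq_from_tnth => i; rewrite tnth_mktuple !(tnth_nth y) /= nth_rcons.
  by rewrite size_tuple ltn_ord.
- move=> x _; apply: val_inj => /=.
  have x0 := tnth x ord_max.
  apply: (@eq_from_nth _ x0); first by rewrite size_rcons !size_tuple card_ord.
  move=> i; rewrite size_rcons size_map size_enum_ord => ltin.
  rewrite nth_rcons size_map size_enum_ord.
  case: ltnP => [lt_in|le_ni].
    rewrite (nth_map (Ordinal lt_in)) ?size_enum_ord // (tnth_nth x0) /=.
    by rewrite nth_enum_ord.
  have -> : i = n by apply/eqP; rewrite eqn_leq le_ni andbT -ltnS.
  by rewrite eqxx (tnth_nth x0).
Qed.

Lemma sum_tuple_cons n (f : n.+1.-tuple X -> R) (P : pred (seq X)) :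
  \sum_(x : n.+1.-tuple X | P (tval x)) f x =
  \sum_(x : n.-tuple X) \sum_(y | P (y :: tval x)) f [tuple of y :: x].
Proof.
pose h (z : n.-tuple X * X) := [tuple of z.2 :: z.1].
rewrite pair_big_dep /= (reindex h) //=.
exists (fun x : n.+1.-tuple X => ([tuple of behead x], thead x)).
- by move=> [x y] _ /=; congr (_, _); apply: val_inj.
- by move=> x _; rewrite /h /= -tuple_eta.
Qed.

Lemma sum_tuple1 (f : 1.-tuple X -> R) : \sum_x f x = \sum_a f [tuple a].
Proof.
rewrite (reindex (fun a => [tuple a])) //; exists (fun x => tnth x ord0) => [a|x] _.
  by [].
by apply: eq_from_tnth => i; rewrite !ord1.
Qed.

Lemma iid1 (p : X -> R) x : iid p 1 x = p (tnth x ord0).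
Proof. by rewrite /iid big_ord1. Qed.

Lemma iid1_tuple1 (q : 1.-tuple X -> R) : iid (fun a => q [tuple a]) 1 = q.
Proof.
apply/funext => x; rewrite iid1; congr q.
by apply: eq_from_tnth => i; rewrite !ord1.
Qed.

Lemma KL_iid1 (q p : X -> R) : KL (iid q 1) (iid p 1) = KL q p.
Proof.
rewrite /KL sum_tuple1.
have -> : [exists x : 1.-tuple X, (iid q 1 x != 0) && (iid p 1 x == 0)] =
          [exists x, (q x != 0) && (p x == 0)].
  apply/existsP/existsP => [[x H]|[x H]].
    by exists (tnth x ord0); move: H; rewrite !iid1.
  by exists [tuple x]; rewrite !iid1.
by under eq_bigr do rewrite !iid1.
Qed.

End TupleSums.

(** * Types of words *)

Section Freq.
Variables (R : realType) (X : finType).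

(** The type, or empirical distribution, of the word [x]. *)
Definition freq n (x : n.-tuple X) : X -> R :=
  fun a => (count_mem a x)%:R / n%:R.

Lemma sum_count_mem n (x : n.-tuple X) (g : X -> R) :
  \sum_a (count_mem a x)%:R * g a = \sum_(i < n) g (tnth x i).
Proof.
rewrite -(big_tuple _ _ x xpredT g).
elim: (tval x) => [|b s IH]; first by rewrite big_nil big1 // => a _; rewrite mul0r.
rewrite big_cons -IH (bigD1 b) //= [in RHS](bigD1 b) //= eqxx natrD mulrDl mul1r.
rewrite -!addrA; congr (_ + (_ + _)).
by apply: eq_bigr => a /negbTE; rewrite eq_sym => ->; rewrite add0n.
Qed.

Lemma sum_freq n (x : n.-tuple X) (g : X -> R) :
  \sum_a freq x a * g a = (\sum_(i < n) g (tnth x i)) / n%:R.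
Proof.
rewrite -sum_count_mem mulr_suml; apply: eq_bigr => a _.
by rewrite /freq mulrAC.
Qed.

Lemma freq_ge0 n (x : n.-tuple X) a : 0 <= freq x a.
Proof. by rewrite divr_ge0. Qed.

Lemma is_dist_freq n (x : n.-tuple X) : (0 < n)%N -> is_dist (freq x).
Proof.
move=> n0; split=> [a|]; first exact: freq_ge0.
have := sum_freq x (fun=> 1); rewrite sumr_const card_ord.
rewrite divff ?pnatr_eq0 -?lt0n // => <-.
by apply: eq_bigr => a _; rewrite mulr1.
Qed.

End Freq.

(** * Sampling coordinates without replacement *)

Section Subtuples.
Variables (R : realType) (X : finType).
Implicit Types (n m : nat).

Definition subtuple n m (x : n.-tuple X) (iota : m.-tuple 'I_n) : m.-tuple X :=
  [tuple of map (tnth x) iota].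

Definition marg_along n m (q : n.-tuple X -> R) (iota : m.-tuple 'I_n) :
    m.-tuple X -> R :=
  fun y => \sum_(x | subtuple x iota == y) q x.

(** Choose the indices one by one: of the positions of [x] carrying the wanted letter, at most
    [m <= D] are already taken. The bound [D] is separate from [m] so that the factors stay the same
    along the induction. *)
Lemma count_injections n m D (x : n.-tuple X) (y : m.-tuple X) : (m <= D)%N ->
  \prod_(j < m) (count_mem (tnth y j) x - D)%:R <=
  \sum_(iota : m.-tuple 'I_n | uniq iota && (subtuple x iota == y)) 1 :> R.
Proof.
elim: m y => [|m IH] y leD.
  rewrite big_ord0 (bigD1 [tuple]) //=; last by rewrite [y]tuple0; apply/eqP/val_inj.
  by rewrite lerDl sumr_ge0.
case/tupleP: y => b y.
rewrite (eq_bigl (fun iota : m.+1.-tuple 'I_n =>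
  uniq (tval iota) && (map (tnth x) (tval iota) == b :: y))) //.
rewrite (sum_tuple_cons (fun=> 1) (fun s => uniq s && (map (tnth x) s == b :: y))).
rewrite big_ord_recl tnth0.
under eq_bigr => j _ do rewrite tnthS.
apply: (@le_trans _ _ (\sum_(iota : m.-tuple 'I_n |
    uniq iota && (subtuple x iota == y)) (count_mem b x - D)%:R)).
  have -> : \sum_(iota : m.-tuple 'I_n | uniq iota && (subtuple x iota == y))
      (count_mem b x - D)%:R = (count_mem b x - D)%:R *
      \sum_(iota : m.-tuple 'I_n | uniq iota && (subtuple x iota == y)) 1 :> R.
    by rewrite mulr_sumr; apply: eq_bigr => ? _; rewrite mulr1.
  by rewrite ler_wpM2l // IH // ltnW.
rewrite [leRHS](bigID (fun iota : m.-tuple 'I_n => uniq iota && (subtuple x iota == y))) /=.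
rewrite -[leLHS]addr0 lerD //; last by apply: sumr_ge0 => *; apply: sumr_ge0.
apply: ler_sum => iota /andP[ui /eqP si].
rewrite sumr_const ler_nat.
have -> : count_mem b x = #|[pred i | tnth x i == b]|.
  by rewrite -sum1_count big_tuple -sum1_card.
rewrite leq_subLR.
apply: (@leq_trans (#|[pred i | i \in iota]| + #|[pred i | (i \notin iota) && (tnth x i == b)]|)).
  rewrite -(cardID [pred i | i \in iota] [pred i | tnth x i == b]).
  apply: leq_add; apply: subset_leq_card; apply/fintype.subsetP => i; rewrite !inE.
    by case/andP.
  by [].
apply: leq_add.
  apply: leq_trans leD; apply: leq_trans (ltnW (ltnSn m)).
  by rewrite (card_uniqP ui) size_tuple.
apply: subset_leq_card; apply/fintype.subsetP => i; rewrite !inE => /andP[ni /eqP xb].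
rewrite unfold_in ni ui xb eqseq_cons eqxx /=.
by move/(congr1 val): si => /= ->.
Qed.

(** Double counting: after exchanging the sums, each [x] in [B] is weighted by the number of
    injective choices that read [y] in it. This number is at least [(theta * n) ^ m] times
    [iid t m y], and [n ^_ m <= n ^ m]. *)
Lemma sum_marg_along_ge n m (q : n.-tuple X -> R) (B : pred (n.-tuple X))
    (t : X -> R) (theta : R) (y : m.-tuple X) :
  (0 < n)%N -> (m <= n)%N ->
  (forall x, 0 <= q x) -> (forall a, 0 <= t a) -> 0 <= theta ->
  (forall x a, B x -> 0 < t a -> theta * t a * n%:R <= (count_mem a x - m)%:R) ->
  (\sum_(x | B x) q x) * theta ^+ m * iid t m y <=
  (\sum_(iota : m.-tuple 'I_n | uniq iota) marg_along q iota y) / (n ^_ m)%:R.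
Proof.
move=> n0 lemn q0 t0 th0 HB.
have nm0 : (0 < n ^_ m)%N by rewrite ffact_gt0.
rewrite ler_pdivlMr ?ltr0n //.
have -> : \sum_(iota : m.-tuple 'I_n | uniq iota) marg_along q iota y =
    \sum_x q x * \sum_(iota : m.-tuple 'I_n | uniq iota && (subtuple x iota == y)) 1.
  rewrite /marg_along (exchange_big_dep xpredT) //=.
  by apply: eq_bigr => x _; rewrite mulr_sumr; apply: eq_bigr => *; rewrite mulr1.
rewrite [leRHS](bigID B) /= -[leLHS]addr0 lerD //; last first.
  by apply: sumr_ge0 => x _; rewrite mulr_ge0 // sumr_ge0.
rewrite !mulr_suml; apply: ler_sum => x Bx; rewrite -!mulrA ler_wpM2l //.
have [it0|/negP it0] := boolP (iid t m y == 0).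
  by rewrite (eqP it0) !(mul0r, mulr0) sumr_ge0.
have tj j : 0 < t (tnth y j).
  rewrite lt_neqAle t0 andbT eq_sym; apply/negP => /eqP tj; apply: it0.
  by rewrite /iid (bigD1 j) //= tj mul0r.
apply: le_trans (count_injections x y (leqnn m)).
apply: (@le_trans _ _ (\prod_(j < m) (theta * t (tnth y j) * n%:R))).
  rewrite !big_split /= !prodr_const !card_ord -/(iid t m y) mulrA ler_wpM2l //.
    by rewrite mulr_ge0 ?exprn_ge0 // prodr_ge0.
  rewrite -natrX ler_nat ffact_prod -[X in (_ <= X ^ _)%N]subn0.
  rewrite -[X in (_ <= _ ^ X)%N](card_ord m) -prod_nat_const.
  by apply: leq_prod => i _; rewrite subn0 leq_subr.
by apply: ler_prod => j _; rewrite HB // !mulr_ge0.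
Qed.

(** The listed indices followed by all the others form a rearrangement of ['I_(d + m)]; [s] is that
    rearrangement. *)
Lemma uniq_tuple_perm d m (iota : m.-tuple 'I_(d + m)) : uniq iota ->
  exists s : {perm 'I_(d + m)}, forall j : 'I_m,
    s (cast_ord (addnC m d) (lshift d j)) = tnth iota j.
Proof.
move=> ui.
pose rest := [seq i <- enum 'I_(d + m) | i \notin (iota : seq _)].
have pe : perm_eq (iota ++ rest) (ord_tuple (d + m)).
  apply: uniq_perm.
  - rewrite cat_uniq ui filter_uniq ?enum_uniq // andbT /=.
    by apply/hasPn => i; rewrite mem_filter => /andP[].
  - by rewrite val_ord_tuple enum_uniq.
  - move=> i; rewrite mem_cat mem_filter val_ord_tuple mem_enum andbT.
    by case: (i \in (iota : seq _)).
have [s /= Es] := tuple_permP pe.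
exists s => j.
have i0 := tnth iota j.
have lt : (j < d + m)%N by rewrite (leq_trans (ltn_ord j)) // leq_addl.
have : nth i0 (iota ++ rest) j = tnth iota j.
  by rewrite nth_cat size_tuple ltn_ord (tnth_nth i0).
rewrite Es (nth_map (Ordinal lt)) ?size_enum_ord // tnth_ord_tuple => <-.
by congr (s _); apply: val_inj => /=; rewrite nth_enum_ord.
Qed.

End Subtuples.

(** * Bounds on the Kullback-Leibler divergence *)

Section Divergence.
Variables (R : realType) (T : finType).

Lemma KL_le_of_dominated (p q : T -> R) (K : R) : is_dist p -> 0 < K ->
  (forall x, K * p x <= q x) -> (KL p q <= (- ln K)%:E)%E.
Proof.
move=> [p0 p1] K0 Kpq; rewrite /KL.
case: existsP => [[x /andP[px /eqP qx]]|_].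
  have := Kpq x; rewrite qx pmulr_rle0 // => px'.
  by move: px; rewrite eq_le px' p0.
rewrite lee_fin -[leRHS]mul1r -p1 mulr_suml; apply: ler_sum => x _.
case: eqP => [->|/eqP px]; first by rewrite mul0r.
have px0 : 0 < p x by rewrite lt_neqAle eq_sym px p0.
have qx0 : 0 < q x by apply: lt_le_trans (Kpq x); apply: mulr_gt0.
rewrite ler_wpM2l // -lnV ?posrE // ler_ln ?posrE ?divr_gt0 ?invr_gt0 //.
rewrite ler_pdivrMr // mulrC ler_pdivlMr //.
by rewrite mulrC.
Qed.

(* [g] is the log-likelihood ratio of [r] against [p], where [r] is [s] mixed
   with a little of [p] so that [g] stays finite off the support of [s]. *)
Lemma KL_gt_tilt (s p : T -> R) (L : R) : is_dist s -> is_dist p ->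
  (L%:E < KL s p)%E -> exists r g : T -> R,
  [/\ is_dist r, forall a, p a <= r a * expR (- g a) & L < \sum_a s a * g a].
Proof.
move=> [s0 s1] dp; have [p0 p1] := dp; rewrite /KL.
case: existsP => [[a /andP[sa /eqP pa]] _|/forallNP nsp].
  have sa0 : 0 < s a by rewrite lt_neqAle eq_sym sa s0.
  (* Infinite divergence: [p] vanishes at [a], so [g a] may be as large as desired; this value makes
     the mean of [g] under [s] equal to [|L| + 1]. *)
  exists p, (fun b => if b == a then (`|L| + 1) / s a else 0); split => // [b|].
    by case: eqP => [->|_]; rewrite ?pa ?mul0r // oppr0 expR0 mulr1.
  rewrite (bigD1 a) //= eqxx big1 ?addr0 => [|b /negbTE ->]; last by rewrite mulr0.
  rewrite mulrC divfK //; have := ler_norm L; lra.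
set D := \sum_x _; rewrite lte_fin => LD.
(* Mixing with weight [e = exp (- d)] gives [r >= e * s], so the log-likelihood ratio loses at most
   [d], half of the gap [D - L]. *)
have [d [d0 dD]] : exists d : R, 0 < d /\ L < D - d by exists ((D - L) / 2); split; lra.
have [e [e0 e1 lne]] : exists e : R, [/\ 0 < e, e < 1 & ln e = - d].
  exists (expR (- d)); rewrite expR_gt0 expRK expR_lt1; split=> //; lra.
pose r a := e * s a + (1 - e) * p a.
have e1' : 0 < 1 - e by lra.
have r0 a : 0 <= r a by rewrite addr_ge0 // mulr_ge0 // ltW.
have sp a : 0 < s a -> 0 < p a.
  move=> sa; rewrite lt_neqAle p0 andbT eq_sym; apply/eqP => pa.
  by apply: (nsp a); rewrite pa eqxx gt_eqF.
exists r, (fun a => ln (r a / p a)); split.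
- split=> //; rewrite big_split /= -!mulr_sumr s1 p1; lra.
- move=> a; have [->|/eqP pa] := eqVneq (p a) 0.
    by rewrite mulr_ge0 // expR_ge0.
  have pa0 : 0 < p a by rewrite lt_neqAle eq_sym p0 andbT; apply/eqP.
  have ra0 : 0 < r a.
      by apply: ltr_wpDl; [apply: mulr_ge0 => //; exact: ltW|exact: mulr_gt0].
  by rewrite expRN lnK ?posrE ?divr_gt0 // invf_div mulrC divfK // gt_eqF.
- apply: (lt_le_trans dD); rewrite -[d]mulr1 -s1 mulr_sumr /D -sumrB.
  apply: ler_sum => a _; have [->|/eqP sa] := eqVneq (s a) 0.
    by rewrite mulr0 mul0r subr0.
  have sa0 : 0 < s a by rewrite lt_neqAle eq_sym s0 andbT; apply/eqP.
  have pa0 := sp a sa0.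
  rewrite mulrC -mulrBl [leRHS]mulrC ler_wpM2r //.
  have -> : ln (s a / p a) - d = ln (e * s a / p a).
    by rewrite -mulrA [in RHS]lnM ?posrE ?divr_gt0 // lne addrC.
  have es0 : 0 < e * s a by rewrite mulr_gt0.
  have rs : e * s a <= r a by rewrite lerDl mulr_ge0 // ltW.
  have ra0 := lt_le_trans es0 rs.
  rewrite ler_ln ?posrE ?divr_gt0 //.
  by rewrite ler_wpM2r // invr_ge0 ltW.
Qed.

Lemma sum_le_cover (P P1 P2 : pred T) (f : T -> R) : (forall x, 0 <= f x) ->
  (forall x, P x -> P1 x || P2 x) ->
  \sum_(x | P x) f x <= \sum_(x | P1 x) f x + \sum_(x | P2 x) f x.
Proof.
move=> f0 H; rewrite [leLHS]big_mkcond (big_mkcond P1) (big_mkcond P2) -big_split.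
apply: ler_sum => x _ /=; have fx := f0 x; have := H x.
by case: (P x); case: (P1 x); case: (P2 x) => //= PP; try lra; have := PP isT.
Qed.

End Divergence.

(** * Sets of types of exponentially small probability *)

Section ExpSmall.
Variables (R : realType) (X : finType).

(** The constant [C] makes the notion stable under finite unions at the same rate [L]. *)
Definition exp_small (p : X -> R) (L : R) (V : set (X -> R)) : Prop :=
  exists2 C : R, 0 <= C & forall n, (0 < n)%N ->
    \sum_(x : n.-tuple X | `[< V (freq R x) >]) iid p n x <= C * expR (- L) ^+ n.

(** Change of measure: [iid p n x] is at most [iid r n x] times [exp] of minus the sum of the
    [g (tnth x i)]. On the half-space this sum exceeds [n * L], and [iid r n] has total mass 1. *)
Lemma exp_small_halfspace (p r g : X -> R) (L : R) : is_dist p -> is_dist r ->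
  (forall a, p a <= r a * expR (- g a)) ->
  exp_small p L [set u | L < \sum_a u a * g a].
Proof.
move=> [p0 p1] dr pr; have [r0 r1] := dr; exists 1 => // n n0; rewrite mul1r.
have n0' : (0 : R) < n%:R by rewrite ltr0n.
have [_ R1] := is_dist_iid n dr.
rewrite -[leRHS]mul1r -R1 mulr_suml big_mkcond /=.
apply: ler_sum => x _; case: asboolP => [|_]; last first.
  by rewrite mulr_ge0 ?exprn_ge0 ?expR_ge0 ?prodr_ge0.
rewrite /= sum_freq ltr_pdivlMr // => Lx.
apply: (@le_trans _ _ (\prod_(i < n) (r (tnth x i) * expR (- g (tnth x i))))).
  by apply: ler_prod => i _; rewrite p0 pr.
rewrite big_split /= ler_wpM2l ?prodr_ge0 // -expR_sum -expRM_natr ler_expR.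
by rewrite sumrN mulNr lerN2 ltW.
Qed.

Lemma exp_smallU (p : X -> R) L (U V : set (X -> R)) : is_dist p ->
  exp_small p L U -> exp_small p L V -> exp_small p L (U `|` V).
Proof.
move=> [p0 _] [C C0 H] [D D0 K]; exists (C + D); first exact: addr_ge0.
move=> n n0; rewrite mulrDl; apply: le_trans (lerD (H n n0) (K n n0)).
apply: sum_le_cover => x; first exact: prodr_ge0.
by move/asboolP => [] ?; apply/orP; [left|right]; apply/asboolP.
Qed.

End ExpSmall.

(** * Compactness of the simplex and covering arguments *)

Section Simplex.
Variables (R : realType) (X : finType).

Lemma ptws_coord_continuous (a : X) : continuous (fun u : {ptws X -> R} => u a : R).
Proof. exact: (@proj_continuous X (fun=> R) a). Qed.

Lemma pairing_continuous (g : X -> R) :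
  continuous (fun u : {ptws X -> R} => \sum_a u a * g a : R).
Proof.
apply: (@continuous_big R X +%R 0 xpredT _ {ptws X -> R} (index_enum X)
  (fun a (u : {ptws X -> R}) => u a * g a)).
  exact: add_continuous.
by move=> a _ u; exact: (cvgMr_tmp (@ptws_coord_continuous a u)).
Qed.

(** A closed subset of the cube [[0, 1]^X], which is compact by Tychonoff. *)
Lemma compact_simplex : compact [set u : {ptws X -> R} | is_dist u].
Proof.
apply: (@subclosed_compact _ _ [set u : {ptws X -> R} | forall a, `[0, 1]%classic (u a)]).
- rewrite (_ : [set u | _] = (\bigcap_a [set u : {ptws X -> R} | 0 <= u a]) `&`
     [set u : {ptws X -> R} | \sum_a u a * 1 = 1]).
    apply: closedI.
      apply: closed_bigI => a _.
      exact: (@preimage_closed _ _ (fun u : {ptws X -> R} => u a) [set y | 0 <= y]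
        (in1W (@ptws_coord_continuous a)) (@closed_ge _ 0)).
    exact: (@preimage_closed _ _ (fun u : {ptws X -> R} => \sum_a u a * 1) [set 1]
        (in1W (@pairing_continuous (fun=> 1))) (@closed_eq _ 1)).
  apply/seteqP; split => u /= [u0 u1]; split.
  + by move=> a _; exact: u0.
  + by under eq_bigr do rewrite mulr1.
  + by move=> a; exact: (u0 a).
  + by move: u1; under eq_bigr do rewrite mulr1.
- exact: (@tychonoff X (fun=> R) (fun=> `[0, 1]%classic) (fun=> @segment_compact R 0 1)).
- move=> u [u0 u1] a /=; rewrite in_itv /= u0 -u1 (bigD1 a) //= lerDl.
  exact: sumr_ge0.
Qed.

End Simplex.

(** If [K] were not good, the sets [K] minus a good set would generate a proper filter. A cluster
    point in [K] has a good neighbourhood, which would have to meet its own complement. *)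
Lemma compact_induction (T : topologicalType) (K : set T) (good : set T -> Prop) :
  compact K -> good set0 ->
  (forall U V, U `<=` V -> good V -> good U) ->
  (forall U V, good U -> good V -> good (U `|` V)) ->
  (forall u, K u -> exists2 V, nbhs u V & good V) -> good K.
Proof.
move=> cK g0 gS gU gK; apply: contrapT => nK.
pose G : set_system T := [set A | exists2 V, good V & K `\` V `<=` A].
have PG : ProperFilter G.
  split; first by move=> [V gV KV]; apply: nK; apply: gS gV => u Ku;
    apply: contrapT => nV; apply: (KV u).
  split.
  - by exists set0.
  - move=> A B [U gUU KU] [V gV KV]; exists (U `|` V); first exact: gU.
    by move=> u [Ku nUV]; split; [apply: KU|apply: KV]; split => // ?;
      apply: nUV; [left|right].
  - by move=> A B AB [V gV KV]; exists V => // u /KV /AB.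
have [u [Ku cu]] : K `&` cluster G !=set0.
  by apply: cK; exists set0 => // u [].
have [V nV gV] := gK u Ku.
have [|v [[Kv nVv] Vv]] := cu (K `\` V) V _ nV; first by exists V.
exact: nVv.
Qed.

Lemma cvge_of_bounds (R : realType) (u : nat -> \bar R) (l : \bar R) :
  (forall L : R, (L%:E < l)%E -> \forall n \near \oo, (L%:E <= u n)%E) ->
  (forall U : R, (l < U%:E)%E -> \forall n \near \oo, (u n <= U%:E)%E) ->
  u @ \oo --> l.
Proof.
case: l => [r| |] lo up.
- move=> A [/= e e0 eA].
  have e20 : 0 < e / 2 by rewrite divr_gt0.
  have := lo (r - e / 2); rewrite lte_fin ltrBlDr ltrDl => /(_ e20) lo'.
  have := up (r + e / 2); rewrite lte_fin ltrDl => /(_ e20) up'.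
  change (\forall n \near \oo, A (u n)); move: lo' up'; apply: filterS2 => n.
  case: (u n) => [x| |] //; rewrite !lee_fin => xl xu.
  apply: eA => /=; rewrite ltr_distlC; apply/andP; split; lra.
- by apply/cvgeyPge => A; apply: lo; rewrite ltry.
- by apply/cvgeNyPle => A; apply: up; rewrite ltNyr.
Qed.

(** * The strong converse of Stein's lemma *)

Section Stein.
Variables (R : realType) (X : finType).

(** From [exp (- z) >= 1 - z] follows [exp z <= 1 / (1 - z)], and [(1 + z + 2 z^2) (1 - z) = 1 + z^2
    (1 - 2 z)]. *)
Lemma expR_le_quadratic (z : R) : `|z| <= 1 / 2 -> expR z <= 1 + z + 2 * z ^+ 2.
Proof.
rewrite ler_norml => /andP[z1 z2].
have := expR_ge1Dx (- z); rewrite expRN => h.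
have ez := expR_gt0 z.
have h' : expR z * (1 - z) <= 1.
  by rewrite mulrC -ler_pdivlMr // mul1r.
have z3 : 0 < 1 - z by lra.
rewrite -(ler_pM2r z3); apply: le_trans h' _.
rewrite -subr_ge0 (_ : _ - 1 = z ^+ 2 * (1 - 2 * z)); last by ring.
by rewrite mulr_ge0 ?sqr_ge0 //; lra.
Qed.

(** The moment generating function of [h] equals 1 at 0 and has slope [- d < 0] there. *)
Lemma chernoff_rate (s h : X -> R) (d : R) : is_dist s -> 0 < d ->
  \sum_a s a * h a = - d ->
  exists lam, 0 <= lam /\ \sum_a s a * expR (lam * h a) < 1.
Proof.
move=> [s0 s1] d0 mean.
have [M [M1 dM HM]] : exists M : R, [/\ 1 <= M, d <= M & forall a, `|h a| <= M].
  exists (1 + d + \sum_a `|h a|).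
  have S0 : 0 <= \sum_a `|h a| by apply: sumr_ge0.
  split; [lra|lra|] => a; rewrite (bigD1 a) //=.
  have : 0 <= \sum_(i | i != a) `|h i| by apply: sumr_ge0.
  by have := normr_ge0 (h a); lra.
have M0 : 0 < M by lra.
have M20 : 0 < M ^+ 2 by rewrite exprn_gt0.
(* With this [lam] the quadratic error [2 * lam^2 * M^2] is [lam * d / 2], half of the linear gain
   [lam * d]. *)
have [lam [lam0 lamE]] : exists lam : R, 0 < lam /\ lam * M ^+ 2 = d / 4.
  exists (d / (4 * M ^+ 2)); split; first by rewrite divr_gt0 // mulr_gt0.
  by field; rewrite gt_eqF.
have lamM : lam * M <= 1 / 2.
  by rewrite -(ler_pM2r M0) -mulrA -expr2 lamE; lra.
exists lam; split; first exact: ltW.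
apply: (@le_lt_trans _ _ (\sum_a s a * (1 + lam * h a + 2 * (d / 4 * lam)))).
  apply: ler_sum => a _; rewrite ler_wpM2l //.
  apply: le_trans (expR_le_quadratic _) _.
    rewrite normrM gtr0_norm //; apply: le_trans lamM.
    by rewrite ler_wpM2l // ltW.
  have hM2 : h a ^+ 2 <= M ^+ 2.
    by rewrite -(real_normK (num_real (h a))) ler_sqr ?nnegrE // ltW.
  rewrite lerD2l -lamE.
  have -> : 2 * (lam * h a) ^+ 2 = (2 * lam * lam) * h a ^+ 2 by ring.
  have -> : 2 * (lam * M ^+ 2 * lam) = (2 * lam * lam) * M ^+ 2 by ring.
  have lam0' := ltW lam0.
  by apply: ler_wpM2l => //; rewrite !mulr_ge0.
under eq_bigr do rewrite !mulrDr mulr1 mulrCA.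
rewrite !big_split /= -mulr_sumr -mulr_suml s1 mean.
have : 0 < lam * d by rewrite mulr_gt0.
by lra.
Qed.

(** Let [z] be the sum of the log-likelihood ratios minus [n * (D + d)]. The difference of the two
    measures at [x] is [iid s n x * (1 - exp (- z))], at most [iid s n x * exp (lam * z)], whose sum
    over [x] is [rho ^ n] by the product structure. *)
Lemma stein_test_bound (s p : X -> R) (D d : R) : is_dist s -> is_dist p ->
  KL s p = D%:E -> 0 < d -> exists rho : R, [/\ 0 <= rho, rho < 1 &
    forall n (a : n.-tuple X -> R), (forall x, 0 <= a x <= 1) ->
    \sum_x a x * iid s n x - expR (D + d) ^+ n * \sum_x a x * iid p n x <= rho ^+ n].
Proof.
move=> ds [p0 p1]; have [s0 s1] := ds; rewrite /KL.
case: existsP => // /forallNP nsp [mean] d0.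
have sp a : 0 < s a -> 0 < p a.
  move=> sa; rewrite lt_neqAle p0 andbT eq_sym; apply/eqP => pa.
  by apply: (nsp a); rewrite pa eqxx gt_eqF.
pose h a := ln (s a / p a) - (D + d).
have [|lam [lam0 rho1]] := chernoff_rate (h := h) ds d0.
  rewrite /h; under eq_bigr do rewrite mulrBr.
  rewrite sumrB -mulr_suml s1 mul1r (_ : \sum_i _ = D); first by lra.
  by rewrite -mean; apply: eq_bigr => a _; case: eqP => [->|//]; rewrite mul0r.
exists (\sum_a s a * expR (lam * h a)); split => //.
  by apply: sumr_ge0 => a _; rewrite mulr_ge0 ?expR_ge0.
move=> n a a01; rewrite -sum_tuple_prod mulr_sumr -sumrB.
apply: ler_sum => x _; have /andP[a0 a1] := a01 x.
set w := \prod_(i < n) _.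
have w0 : 0 <= w by apply: prodr_ge0 => i _; rewrite mulr_ge0 ?expR_ge0.
rewrite mulrCA -mulrBr; apply: (@le_trans _ _ (a x * w)); last first.
  by rewrite ler_piMl.
rewrite ler_wpM2l // {a a01 a0 a1}.
have [sx0|sx0] := eqVneq (iid s n x) 0.
  rewrite sx0 sub0r (le_trans _ w0) // oppr_le0 mulr_ge0 ?exprn_ge0 ?expR_ge0 //.
  exact: prodr_ge0.
have si i : 0 < s (tnth x i).
  rewrite lt_neqAle s0 andbT eq_sym; apply: contra_neq sx0 => si.
  by rewrite /iid (bigD1 i) //= si mul0r.
pose z := \sum_(i < n) h (tnth x i).
have -> : w = iid s n x * expR (lam * z).
  by rewrite /w big_split /= -expR_sum mulr_sumr.
have -> : expR (D + d) ^+ n * iid p n x = iid s n x * expR (- z).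
  rewrite -sumrN expR_sum -big_split /=.
  have -> : expR (D + d) ^+ n = \prod_(i < n) expR (D + d).
    by rewrite prodr_const card_ord.
  rewrite -big_split.
  apply: eq_bigr => i _ /=; rewrite /h opprB expRB lnK; last first.
    by rewrite posrE divr_gt0 // sp.
  have pi := sp _ (si i); field.
  by rewrite !gt_eqF.
rewrite -[X in X - _]mulr1 -mulrBr ler_wpM2l ?prodr_ge0 //.
(* For [z >= 0] the right side is at least 1; for [z < 0] the left factor is negative. *)
have [z0|z0] := leP 0 z.
  have : 1 <= expR (lam * z) by rewrite -expR0 ler_expR mulr_ge0.
  by have := expR_gt0 (- z); lra.
have : 1 <= expR (- z) by rewrite -expR0 ler_expR oppr_ge0 ltW.
by have := expR_gt0 (lam * z); lra.
Qed.

(** An admissible test has mass at least [1 - eps] under [iid s n]. Once [rho ^ n < (1 - eps) / 2],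
    the remaining [(1 - eps) / 2] bounds its mass under [iid p n] from below, up to the factor
    [E]. *)
Lemma DH_iid_le (s p : X -> R) (D d eps : R) : is_dist s -> is_dist p ->
  KL s p = D%:E -> 0 < d -> 0 < eps < 1 ->
  \forall n \near \oo, (DH eps (iid s n) (iid p n) <=
    (n%:R * (D + d) - ln ((1 - eps) / 2))%:E)%E.
Proof.
move=> ds dp KD d0 /andP[e0 e1].
have [rho [rho0 rho1 H]] := stein_test_bound ds dp KD d0.
have k0 : 0 < (1 - eps) / 2 by lra.
have : \forall n \near \oo, rho ^+ n < (1 - eps) / 2.
  have /cvgr_lt : (GRing.exp rho : R ^nat) @ \oo --> 0.
    by apply: cvg_expr; rewrite ger0_norm.
  exact.
apply: filterS => n rn.
set E := expR (D + d) ^+ n.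
have E0 : 0 < E by rewrite exprn_gt0 // expR_gt0.
have [q0 q1] := is_dist_iid n ds.
have lb : (1 - eps) / 2 / E <= beta_test eps (iid s n) (iid p n).
  apply: lb_le_inf.
    exists (\sum_x 1 * iid p n x), (fun=> 1); split; first by rewrite ler01 lexx.
    by split => //; rewrite big1 ?ltW // => x _; rewrite subrr mul0r.
  move=> _ [a [a01 [ae ->]]].
  rewrite ler_pdivrMr // mulrC; have := H n a a01; rewrite -/E.
  move: ae; under eq_bigr do rewrite mulrBl mul1r.
  rewrite sumrB q1; lra.
have b0 : 0 < beta_test eps (iid s n) (iid p n).
  by apply: lt_le_trans lb; rewrite divr_gt0.
rewrite /DH gt_eqF // lee_fin.
have : ln ((1 - eps) / 2 / E) <= ln (beta_test eps (iid s n) (iid p n)).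
  by rewrite ler_ln ?posrE // divr_gt0.
rewrite ln_div ?posrE // /E lnXn ?expR_gt0 // expRK -mulr_natl; lra.
Qed.

End Stein.

(** * Closure properties of the family *)

Section Family.
Variables (R : realType) (X : finType) (F : forall n : nat, set (n.-tuple X -> R)).
Arguments F {n}.
Hypothesis Fdist : forall n (q : n.-tuple X -> R), (0 < n)%N -> F q -> is_dist q.
Hypothesis Fconv : forall n (q1 q2 : n.-tuple X -> R) (t : R), (0 < n)%N ->
  F q1 -> F q2 -> 0 <= t <= 1 -> F (fun x => t * q1 x + (1 - t) * q2 x).
Hypothesis Fmarg : forall n (q : n.+1.-tuple X -> R), (0 < n)%N ->
  F q -> F (marg q).
Hypothesis Ftens : forall n m (q : n.-tuple X -> R) (q' : m.-tuple X -> R),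
  (0 < n)%N -> (0 < m)%N -> F q -> F q' -> F (tensor q q').
Hypothesis Fperm : forall n (s : {perm 'I_n}) (q : n.-tuple X -> R),
  (0 < n)%N -> F q -> F (permd s q).
Hypothesis Fpos : forall p : X -> R, is_dist p -> ~ F (iid p 1%N) ->
  (0 < Dinf (@F) p)%E.

Lemma family_iid (q : 1.-tuple X -> R) n :
  F q -> F (iid (fun a => q [tuple a]) n.+1).
Proof.
move=> Fq; elim: n => [|n IH]; first by rewrite iid1_tuple1.
have := Ftens (ltn0Sn 0) (ltn0Sn n) Fq IH.
congr F; apply/funext => x.
rewrite /tensor /iid [in RHS]big_ord_recl; congr (q _ * _).
  by apply: eq_from_tnth => i; rewrite tnth_mktuple !ord1; congr tnth; apply: val_inj.
apply: eq_bigr => i _; rewrite tnth_mktuple; congr (q [tuple tnth _ _]).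
exact: val_inj.
Qed.

Lemma family_mean n (I : eqType) (f : I -> n.-tuple X -> R) (s : seq I) :
  (0 < n)%N -> (0 < size s)%N -> (forall i, i \in s -> F (f i)) ->
  F (fun y => (\sum_(i <- s) f i y) / (size s)%:R).
Proof.
move=> n0; case: s => // i s _.
elim: s i => [|j s IH] i Ff.
  rewrite [X in F X](_ : _ = f i); first by apply: Ff; rewrite mem_head.
  by apply/funext => y; rewrite big_seq1 divr1.
have k0 : (0 : R) < (size s).+2%:R by rewrite ltr0n.
have := Fconv (t := (size s).+2%:R^-1) n0
  (Ff i (mem_head _ _)) (IH j (fun k ks => Ff k (@mem_behead _ [:: i, j & s] k ks))).
have t01 : 0 <= ((size s).+2%:R^-1 : R) <= 1.
  by rewrite invr_ge0 ler0n andTb invf_le1 // ler1n.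
move=> /(_ t01); congr F; apply/funext => y; rewrite [in RHS]big_cons /=.
set S := \sum_(_ <- _) _.
have : (size s).+1%:R != 0 :> R by rewrite pnatr_eq0.
have : (size s).+2%:R != 0 :> R by rewrite pnatr_eq0.
rewrite -[(size s).+2]addn1 natrD; move: ((size s).+1%:R : R) => k k1 k2.
by field; rewrite k1 k2.
Qed.

Lemma family_prefix d m (q : (d + m).-tuple X -> R) : (0 < m)%N -> F q ->
  F (fun y : m.-tuple X => \sum_(x : (d + m).-tuple X | take m x == y) q x).
Proof.
move=> m0; elim: d q => [|d IH] q Fq.
  rewrite [X in F X](_ : _ = q) //; apply/funext => y.
  rewrite (big_pred1 y) // => x.
  by rewrite -[m in take m](size_tuple x) take_size.
have /IH : F (marg q) by apply: Fmarg => //; rewrite addn_gt0 m0 orbT.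
congr F; apply/funext => y.
rewrite [in RHS](sum_tuple_rcons q (fun s => take m s == y)).
rewrite [in LHS]big_mkcond; apply: eq_bigr => x _.
have E z : take m (rcons x z) = take m x.
  by rewrite -cats1 takel_cat // size_tuple leq_addl.
under [RHS]eq_bigl do rewrite E.
by case: eqP => _; rewrite ?big_pred0_eq.
Qed.

(** A permutation moves the chosen coordinates to the front; what remains is a prefix marginal. *)
Lemma family_marg_along n m (q : n.-tuple X -> R) (iota : m.-tuple 'I_n) :
  (0 < m)%N -> (m <= n)%N -> uniq iota -> F q -> F (marg_along q iota).
Proof.
move=> m0 /subnK; move: (n - m)%N => d En; case: _ / En q iota => q iota ui Fq.
have n0 : (0 < d + m)%N by rewrite addn_gt0 m0 orbT.
have [s Es] := uniq_tuple_perm ui.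
have := family_prefix m0 (Fperm s^-1 n0 Fq).
congr F; apply/funext => y; rewrite /permd /marg_along.
pose h (x : (d + m).-tuple X) := [tuple tnth x (s i) | i < d + m].
rewrite (reindex h) /=; last first.
  exists (fun x => [tuple tnth x (s^-1%g i) | i < d + m]) => x _;
  by apply: eq_from_tnth => i; rewrite !tnth_mktuple ?permK ?permKV.
apply: eq_big => x.
  rewrite -val_eqE /=; congr (_ == _).
  have [m' x0] : exists x0 : X, True by exists (tnth x (Ordinal n0)).
  have sz : size (take m [seq tnth x (s i) | i <- enum 'I_(d + m)]) = m.
    by rewrite size_takel // size_map size_enum_ord leq_addl.
  apply: (@eq_from_nth _ m'); first by rewrite sz size_map size_tuple.
  move=> i; rewrite sz => ltim.
  have ltid : (i < d + m)%N by rewrite (leq_trans ltim) // leq_addl.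
  rewrite nth_take // (nth_map (Ordinal ltid)) ?size_enum_ord //.
  rewrite (nth_map (tnth iota (Ordinal ltim))) ?size_tuple //.
  congr (tnth x _).
  rewrite -(tnth_nth _ iota (Ordinal ltim)) -Es; congr (s _).
  by apply: val_inj => /=; rewrite nth_enum_ord.
move=> _; congr q; apply: eq_from_tnth => i.
by rewrite !tnth_mktuple permKV.
Qed.

(** [n ^_ m] counts the injective index tuples, so this is a uniform average of members of the
    convex set [F]. *)
Lemma family_avg_marg_along n m (q : n.-tuple X -> R) :
  (0 < m)%N -> (m <= n)%N -> F q ->
  F (fun y => (\sum_(iota : m.-tuple 'I_n | uniq iota) marg_along q iota y)
     / (n ^_ m)%:R).
Proof.
move=> m0 lemn Fq.
pose U : pred (m.-tuple 'I_n) := fun iota => uniq iota.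
have cU : #|U| = (n ^_ m)%N.
  rewrite -[in RHS](card_ord n) -card_uniq_tuples cardsE.
  apply: eq_card => iota; rewrite !unfold_in /=.
  by have -> : all 'I_n iota by apply/allP.
have := @family_mean m _ (marg_along q) (enum U) m0.
rewrite -cardE cU ffact_gt0 => /(_ lemn) H.
have /H : forall iota, iota \in enum U -> F (marg_along q iota).
  by move=> iota; rewrite mem_enum => ui; apply: family_marg_along.
by congr F; apply/funext => y; rewrite big_enum.
Qed.

(** * Uniformly rare sets of types and the simultaneous test *)

(** One [N] serves every [q] in [F]; this uniformity lets a single test work against the whole
    family. *)
Definition rare (U : set (X -> R)) : Prop :=
  forall eps : R, 0 < eps -> exists N, forall n (q : n.-tuple X -> R),
  (N <= n)%N -> F q -> \sum_(x | `[< U (freq R x) >]) q x <= eps.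

(* The limit of a divergent sequence is the junk value 0, so [0 < Dinf F t]
   already forces convergence. *)
Lemma Dinf_gt0_bound (t : X -> R) : (0 < Dinf (@F) t)%E ->
  exists c : R, 0 < c /\ exists M, forall n (q : n.-tuple X -> R),
  (M < n)%N -> F q -> ((c * n%:R)%:E <= KL (iid t n) q)%E.
Proof.
rewrite /Dinf; set u := (X in limn X) => u0.
have cu : cvgn u.
  by apply: contrapT => /dvgP Eu; move: u0; rewrite Eu ltxx.
have [c [c0 cl]] : exists c : R, 0 < c /\ (c%:E < limn u)%E.
  move: u0; case: (limn u) => [r| |] //.
    rewrite lte_fin => r0; exists (r / 2); rewrite lte_fin; split; lra.
  by exists 1; rewrite ltry.
have [M _ HM] : \forall n \near \oo, (c%:E < u n)%E.
  have /(_ [set y | c%:E < y]%E) := cu; apply.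
  by apply: open_nbhs_nbhs; split => //; exact: open_ereal_gt_ereal.
exists c; split => //; exists M => n q; case: n q => // n q Mn Fq.
have := ltW (HM n Mn); rewrite /u /= lee_pdivlMl ?ltr0n // mulrC EFinM.
rewrite muleC => /le_trans; apply; apply: ereal_inf_lbound.
by exists q.
Qed.

(** If [q] gave this set mass above [eps], averaging its marginals on [m] coordinates would give a
    member of [F] dominating [eps * th ^ m] times [iid t m]. Its divergence from [iid t m] would be
    at most [m * c / 2 - ln eps], below [c * m] for large [m]. *)
Lemma rare_of_Dinf_gt0 (t : X -> R) : is_dist t -> (0 < Dinf (@F) t)%E ->
  exists2 theta, theta < 1 &
    rare [set u | forall a, 0 < t a -> theta * t a < u a].
Proof.
move=> dt /Dinf_gt0_bound [c [c0 [M HM]]].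
have [t0 t1] := dt.
have [th [th0 th1 lnth]] : exists th : R, [/\ 0 < th, th < 1 & ln th = - (c / 2)].
  exists (expR (- (c / 2))); rewrite expR_gt0 expRK expR_lt1; split=> //; lra.
(* The slack [del] pays for the [m] positions lost when sampling without replacement. *)
have [del [del0 thdel]] : exists del : R, 0 < del /\ th + del < 1.
  by exists ((1 - th) / 2); split; lra.
exists (th + del); first by [].
(* The sum bounds each reciprocal, hence [m = n %/ k] is at most [del * t a * n] for each letter of
   the support of [t]. *)
pose k := (Num.truncn (\sum_a (del * t a)^-1)).+1.
have kP a : 0 < t a -> k%:R^-1 <= del * t a.
  move=> ta; rewrite -[leRHS]invrK lef_pV2 ?posrE ?invr_gt0 ?ltr0n ?mulr_gt0 //.
  apply: le_trans (ltW (truncnS_gt _)); rewrite (bigD1 a) //= lerDl.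
  by apply: sumr_ge0 => b _; rewrite invr_ge0 mulr_ge0 // ltW.
move=> eps eps0.
(* The first entry makes the divergence bound valid at [m], the second makes [c / 2 * m] exceed
   [- ln eps]. *)
pose M' := maxn M.+1 (Num.truncn (2 * - ln eps / c)).+1.
exists (k * M')%N => n q Nn Fq.
pose m := (n %/ k)%N.
have k0 : (0 < k)%N by [].
have M'm : (M' <= m)%N by rewrite leq_divRL // mulnC.
have m0 : (0 < m)%N by apply: leq_trans M'm; rewrite leq_max.
have Mm : (M < m)%N by apply: leq_trans M'm; rewrite leq_max leqnn.
have lnm : - ln eps < c / 2 * m%:R.
  have : 2 * - ln eps / c < m%:R.
    apply: lt_le_trans (truncnS_gt _) _; rewrite ler_nat.
    by apply: leq_trans M'm; rewrite leq_max leqnn orbT.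
  by rewrite ltr_pdivrMr //; lra.
have lemn : (m <= n)%N by exact: leq_div.
have n0 : (0 < n)%N by exact: leq_trans lemn.
have [q0 q1] := Fdist n0 Fq.
rewrite leNgt; apply/negP => big.
have Favg := family_avg_marg_along m0 lemn Fq.
have := HM _ _ Mm Favg.
have K0 : 0 < eps * th ^+ m by rewrite mulr_gt0 // exprn_gt0.
move=> /le_trans /(_ (KL_le_of_dominated (is_dist_iid m dt) K0 _)) H.
have {H} : ((c * m%:R)%:E <= (- ln (eps * th ^+ m))%:E)%E.
  apply: H => y; apply: (@le_trans _ _
    ((\sum_(x | `[< forall a, 0 < t a -> (th + del) * t a < freq R x a >]) q x)
       * th ^+ m * iid t m y)).
    rewrite -!mulrA; apply: ler_wpM2r; last exact: ltW.
    by rewrite mulr_ge0 ?exprn_ge0 ?prodr_ge0 // ltW.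
  apply: sum_marg_along_ge => //; first exact: ltW.
  move=> x a /asboolP /(_ a) Ux ta.
  have {Ux} := Ux ta; rewrite /freq ltr_pdivlMr ?ltr0n // => Ux.
  have mk : m%:R <= del * t a * n%:R.
    apply: (@le_trans _ _ (k%:R^-1 * n%:R)); last by rewrite ler_wpM2r // kP.
    by rewrite mulrC ler_pdivlMr ?ltr0n // -natrM ler_nat leq_divM.
  have : (count_mem a x)%:R - m%:R <= (count_mem a x - m)%:R :> R.
    by rewrite lerBlDr -natrD ler_nat addnC -leq_subLR.
  by apply: le_trans; rewrite lerBrDr; lra.
rewrite lee_fin lnM ?posrE ?exprn_gt0 // lnXn // lnth -mulr_natr.
by lra.
Qed.

Lemma rareU (U V : set (X -> R)) :
  rare U -> rare V -> rare (U `|` V).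
Proof.
move=> rU rV eps eps0.
have e20 : 0 < eps / 2 by rewrite divr_gt0.
have [N1 H1] := rU _ e20; have [N2 H2] := rV _ e20.
exists (maxn N1 N2).+1 => n q Nn Fq.
have [q0 _] := Fdist (leq_ltn_trans (leq0n _) Nn) Fq.
have /andP[n1 n2] : (N1 <= n)%N && (N2 <= n)%N by rewrite -geq_max ltnW.
rewrite [leRHS]splitr; apply: le_trans (lerD (H1 n q n1 Fq) (H2 n q n2 Fq)).
apply: sum_le_cover => // x.
by move/asboolP => [] ?; apply/orP; [left|right]; apply/asboolP.
Qed.

(** The test is the indicator of the types in [V2]: it rejects only types in [V1], which are rare
    under every [q], and its mass under [iid p n] is exponentially small. *)
Lemma DH_set_ge_of_cover (p : X -> R) (L eps : R) (V1 V2 : set (X -> R)) :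
  is_dist p -> 0 < eps -> rare V1 -> exp_small p L V2 ->
  (forall u, is_dist u -> V1 u \/ V2 u) ->
  exists C : R, \forall n \near \oo,
    ((n%:R * L - C)%:E <= DH_set eps F (iid p n))%E.
Proof.
(* [C + 1] keeps the logarithm meaningful when [C = 0]. *)
move=> dp eps0 r1 [C C0 s2] cov; exists (ln (C + 1)).
have [N HN] := r1 eps eps0; exists N.+1 => // n /= Nn.
have n0 : (0 < n)%N by exact: leq_ltn_trans Nn.
apply: le_ereal_inf_tmp => _ [q Fq <-].
have [q0 q1] := Fdist n0 Fq; have [p0 p1] := is_dist_iid n dp.
set b := beta_test eps q (iid p n).
have b0 : 0 <= b.
  apply: lb_le_inf.
    exists (\sum_x 1 * iid p n x), (fun=> 1); split; first by rewrite ler01 lexx.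
    by split => //; rewrite big1 ?ltW // => x _; rewrite subrr mul0r.
  move=> _ [a [a01 [_ ->]]]; apply: sumr_ge0 => x _; rewrite mulr_ge0 //.
  by case/andP: (a01 x).
have C1 : 0 < C + 1 by lra.
have E0 : 0 < expR (- L) ^+ n by rewrite exprn_gt0 // expR_gt0.
have bC : b <= (C + 1) * expR (- L) ^+ n.
  apply: (@le_trans _ _ (C * expR (- L) ^+ n)); last first.
    by rewrite ler_wpM2r ?ltW //; lra.
  apply: le_trans (s2 n n0); apply: ge_inf.
    exists 0 => _ [a [a01 [_ ->]]]; apply: sumr_ge0 => x _; rewrite mulr_ge0 //.
    by case/andP: (a01 x).
  exists (fun x => (`[< V2 (freq R x) >])%:R); split.
    by move=> x; case: asboolP; rewrite ?lexx ?ler01.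
  split.
    apply: le_trans (HN n q (ltnW Nn) Fq); rewrite [leRHS]big_mkcond.
    apply: ler_sum => x _; case: (asboolP (V2 _)) => V2x.
      by rewrite subrr mul0r; case: asboolP.
    rewrite subr0 mul1r; case: asboolP => // V1x.
    by case: (cov _ (is_dist_freq R x n0)).
  rewrite big_mkcond; apply: eq_bigr => x _.
  by case: asboolP; rewrite ?mul1r ?mul0r.
rewrite /DH -/b; case: eqVneq => [_|bn0]; first by rewrite leey.
have b0' : 0 < b by rewrite lt_neqAle eq_sym bn0.
have : ln b <= ln ((C + 1) * expR (- L) ^+ n).
  by rewrite ler_ln ?posrE // mulr_gt0.
rewrite lnM ?posrE // lnXn ?expR_gt0 // expRK lee_fin -mulr_natl; lra.
Qed.

(** Both kinds of sets are stable under finite unions, so by compactness it is enough to cover a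
    neighbourhood of each point by one kind. *)
Lemma simplex_cover (p : X -> R) (L : R) : is_dist p -> (L%:E < DFp (@F) p)%E ->
  exists V1 V2 : set (X -> R), [/\ rare V1, exp_small p L V2 &
    forall u, is_dist u -> V1 u \/ V2 u].
Proof.
move=> dp LD.
pose good (V : set {ptws X -> R}) := exists V1 V2 : set (X -> R),
  [/\ rare V1, exp_small p L V2 & forall u, V u -> V1 u \/ V2 u].
have rare0 : rare set0.
  move=> eps /ltW eps0; exists 0%N => n q _ _.
  by rewrite big_pred0 // => x; apply: asboolF.
have small0 : exp_small p L set0.
  exists 0 => // n _; rewrite mul0r big_pred0 // => x; exact: asboolF.
suff [V1 [V2 [r1 s2 cov]]] : good [set u | is_dist u] by exists V1, V2.
apply: (compact_induction (@compact_simplex R X)).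
- by exists set0, set0.
- by move=> U V UV [V1 [V2 [r1 s2 cov]]]; exists V1, V2; split => // u /UV /cov.
- move=> U V [U1 [U2 [rU sU cU]]] [V1 [V2 [rV sV cV]]].
  exists (U1 `|` V1), (U2 `|` V2); split; [exact: rareU|exact: exp_smallU|].
  by move=> u [/cU|/cV] []; [left; left|right; left|left; right|right; right].
move=> t dt; have [Ft|nFt] := pselect (F (iid t 1%N)).
- have Lt : (L%:E < KL t p)%E.
    apply: lt_le_trans LD _; rewrite -KL_iid1; apply: ereal_inf_lbound.
    by exists (iid t 1%N).
  have [r [g [dr pr Lg]]] := KL_gt_tilt dt dp Lt.
  exists [set u : {ptws X -> R} | L < \sum_a u a * g a].
    exact: (@pairing_continuous R X g t [set y | L < y] (lt_nbhsr Lg)).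
  exists set0, [set u | L < \sum_a u a * g a]; split => //; last by right.
  exact: exp_small_halfspace dr pr.
(* Since [th < 1], the point [t] satisfies the finitely many strict inequalities, which therefore
   hold near [t]. *)
- have [th th1 rth] := rare_of_Dinf_gt0 dt (Fpos dt nFt).
  exists [set u : {ptws X -> R} | forall a, 0 < t a -> th * t a < u a].
    apply: (@filter_forall _ _ (fun a (u : {ptws X -> R}) => 0 < t a -> th * t a < u a)
      (nbhs (t : {ptws X -> R}))) => a.
    have [ta|ta] := ltP 0 (t a); last first.
      by apply: nearW => u ?.
    have tta : th * t a < t a by rewrite gtr_pMl.
    have ntt : nbhs (t : {ptws X -> R}) [set u : {ptws X -> R} | th * t a < u a].
      exact: (@ptws_coord_continuous R X a t [set y | th * t a < y] (lt_nbhsr tta)).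
    apply: (@filterS _ (nbhs (t : {ptws X -> R})) (nbhs_filter _) _ _ _ ntt).
    by move=> u ua _; exact: ua.
  by exists [set u | forall a, 0 < t a -> th * t a < u a], set0; split => //; left.
Qed.

(** * The two rate bounds and the limit *)

Lemma DH_set_lower_rate (p : X -> R) (L eps : R) : is_dist p -> 0 < eps ->
  (L%:E < DFp (@F) p)%E -> \forall n \near \oo,
    (L%:E <= ((n.+1)%:R^-1)%:E * DH_set eps F (iid p n.+1))%E.
Proof.
move=> dp eps0 LD.
(* The gap between [L] and [L'] absorbs the additive constant [C] for large [n]. *)
have [L' [LL' LD']] : exists L', L < L' /\ (L'%:E < DFp (@F) p)%E.
  move: LD; case: (DFp _ _) => [D| |] //; last first.
    by exists (L + 1); rewrite ltry; split => //; lra.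
  by rewrite lte_fin => LD; exists ((L + D) / 2); rewrite lte_fin; split; lra.
have [V1 [V2 [r1 s2 cov]]] := simplex_cover dp LD'.
have [C [N _ H]] := DH_set_ge_of_cover dp eps0 r1 s2 cov.
exists (maxn N (Num.truncn (C / (L' - L)))) => // n /=; rewrite geq_max => /andP[Nn Cn].
rewrite lee_pdivlMl ?ltr0n //; apply: le_trans (H _ (leqW Nn)).
rewrite -EFinM lee_fin.
have : C / (L' - L) < n.+1%:R.
  by apply: lt_le_trans (truncnS_gt _) _; rewrite ler_nat.
rewrite ltr_pdivrMr ?subr_gt0 // mulrBr; lra.
Qed.

Lemma DH_set_upper_rate (p : X -> R) (U eps : R) : is_dist p -> 0 < eps < 1 ->
  (DFp (@F) p < U%:E)%E -> \forall n \near \oo,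
    (((n.+1)%:R^-1)%:E * DH_set eps F (iid p n.+1) <= U%:E)%E.
Proof.
move=> dp eps01 /ereal_inf_lt [_ [q Fq <-]] qU.
pose s a := q [tuple a].
have ds : is_dist s.
  have [q0 q1] := Fdist (ltn0Sn 0) Fq; split=> [a|]; first exact: q0.
  by rewrite -q1 sum_tuple1.
have [D KD DU] : exists2 D : R, KL s p = D%:E & D < U.
  move: qU; rewrite -[q]iid1_tuple1 KL_iid1 -/s /KL; case: ifP => // _ DU.
  by eexists; [reflexivity|rewrite -lte_fin].
(* Half of the gap [U - D] is spent on the Stein exponent, the other half on the constant [C]. *)
have d0 : 0 < (U - D) / 2 by lra.
have [N _ H] := DH_iid_le ds dp KD d0 eps01.
set C := - ln ((1 - eps) / 2) in H.
exists (maxn N (Num.truncn (C / ((U - D) / 2)))) => // n /=; rewrite geq_max => /andP[Nn Cn].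
rewrite lee_pdivrMl ?ltr0n //.
apply: (@le_trans _ _ (DH eps (iid s n.+1) (iid p n.+1))).
  by apply: ereal_inf_lbound; exists (iid s n.+1) => //; exact: family_iid.
apply: le_trans (H _ (leqW Nn)) _; rewrite -EFinM lee_fin.
have : C / ((U - D) / 2) < n.+1%:R.
  by apply: lt_le_trans (truncnS_gt _) _; rewrite ler_nat.
rewrite ltr_pdivrMr //; nra.
Qed.

Lemma DH_set_rate_cvg (p : X -> R) (eps : R) : is_dist p -> 0 < eps < 1 ->
  (fun n : nat => ((n.+1)%:R^-1)%:E * DH_set eps F (iid p n.+1))%E
    @ \oo --> DFp (@F) p.
Proof.
move=> dp eps01; apply: cvge_of_bounds => [L|U].
  by apply: DH_set_lower_rate => //; case/andP: eps01.
exact: DH_set_upper_rate.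
Qed.

End Family.

(** * The limit at each error level and the Sanov exponent *)

Theorem mainTheorem3 (R : realType) (X : finType)
  (F : forall n : nat, set (n.-tuple X -> R))
  (* F_n is a set of probability distributions on X^n *)
  (Fdist : forall n q, (0 < n)%N -> F n q -> is_dist q)
  (* (1) convex and closed *)
  (Fconv : forall n q1 q2 (t : R), (0 < n)%N -> F n q1 -> F n q2 ->
     0 <= t <= 1 -> F n (fun x => t * q1 x + (1 - t) * q2 x))
  (Fclosed : forall n, (0 < n)%N -> @closed {ptws n.-tuple X -> R} (F n))
  (* (2) F_1 contains a full-support distribution *)
  (Ffull : exists q, F 1%N q /\ forall x, 0 < q x)
  (* (3) closed under marginals *)
  (Fmarg : forall n (q : n.+1.-tuple X -> R), (0 < n)%N ->
     F n.+1 q -> F n (marg q))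
  (* (4) closed under tensor products *)
  (Ftens : forall n m q q', (0 < n)%N -> (0 < m)%N -> F n q -> F m q' ->
     F (n + m)%N (tensor q q'))
  (* (5) permutation invariant *)
  (Fperm : forall n (s : {perm 'I_n}) q, (0 < n)%N -> F n q -> F n (permd s q))
  (* (6) D^oo(p||F) > 0 for every p outside F_1 *)
  (Fpos : forall p : X -> R, is_dist p -> ~ F 1%N (iid p 1%N) ->
     (0 < Dinf F p)%E) :
  forall p : X -> R, is_dist p ->
    (forall eps : R, 0 < eps < 1 ->
       (fun n : nat => ((n.+1)%:R^-1)%:E * DH_set eps (F n.+1) (iid p n.+1))%E
         @ \oo --> DFp F p)
    /\
    (fun eps : R => limn_einf (fun n : nat =>
        ((n.+1)%:R^-1)%:E * DH_set eps (F n.+1) (iid p n.+1))%E)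
      @ 0^'+ --> DFp F p.
Proof.
move=> p dp.
have rate eps : 0 < eps < 1 ->
    (fun n : nat => ((n.+1)%:R^-1)%:E * DH_set eps (F n.+1) (iid p n.+1))%E
      @ \oo --> DFp F p.
  exact: (DH_set_rate_cvg Fdist Fconv Fmarg Ftens Fperm Fpos dp).
split => //.
(* For every [eps] in [(0, 1)] the lower limit already equals [DFp F p], so the function is constant
   near [0^'+]. *)
apply: cvg_near_cst; near=> eps.
have eps01 : 0 < eps < 1.
  by apply/andP; split; near: eps; [exact: nbhs_right_gt|exact: nbhs_right_lt].
by have [-> _] := cvg_limn_einf_sup (rate eps eps01).
Unshelve. all: by end_near. Qed.
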